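(* Let $G$ be an abelian group containing a subgroup isomorphic to (and denoted by) $\mathbb Z$, and consider an action of $G$ on the space $\mathcal J$ of bounded Jacobi matrices, with $\mathbb Z$ acting by shifts $n\cdot J=S^nJ$. Fix $z\in\mathbb C^+$, and suppose that $T:G\times\mathcal J\to SL(2,\mathbb C)$ is a cocycle for this action, i.e. $T(gh;J)=T(g;h\cdot J)T(h;J)$ for all $g,h\in G$, $J\in\mathcal J$, which extends the shift cocycle (at this fixed $z$) in the sense that for all $n\in\mathbb Z$ and $J\in\mathcal J$, $T(n;J)$ is the transfer matrix at $z$. If $g\in G$ and $J\in\mathcal J$ satisfy $$\liminf_{n\to\infty}\|T(g;n\cdot J)\|<\infty\quad\text{and}\quad\liminf_{n\to-\infty}\|T(g;n\cdot J)\|<\infty,$$ then $$\pm m_\pm(z;g\cdot J)=T(g;J)\bigl(\pm m_\pm(z;J)\bigr).$$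
   Context: A (bounded) Jacobi matrix is an operator on $\ell^2(\mathbb Z)$ of the form $(Ju)_n=a_nu_{n+1}+a_{n-1}u_{n-1}+b_nu_n$ with bounded sequences $a_n>0$, $b_n\in\mathbb R$; $\mathcal J$ is the set of all of them. We write $\tau u$ for the same difference expression applied to an arbitrary sequence $u$. The shift $S$ sends $J$ to the Jacobi matrix $SJ$ with coefficients $(a_{n+1},b_{n+1})$. The transfer matrix (shift cocycle) at $z$ is given by $T(1;J)=A(J)=\begin{pmatrix}\frac{z-b_1}{a_1}&\frac1{a_1}\\-a_1&0\end{pmatrix}$, $T(n;J)=A((n-1)\cdot J)\cdots A(1\cdot J)A(J)$ and $T(-n;J)=T(n;(-n)\cdot J)^{-1}$ for $n\ge1$, $T(0;J)=1$. $\mathbb C^+=\{z:\operatorname{Im}z>0\}$. The Titchmarsh–Weyl $m$ functions are $m_\pm(z)=m_\pm(z;J)=\mp\dfrac{f_\pm(1,z)}{a_0f_\pm(0,z)}$, $z\in\mathbb C^+$, where $f_\pm$ are the (unique up to a factor) non-trivial solutions of $\tau f=zf$ that are square summable near $\pm\infty$. A matrix $\begin{pmatrix}a&b\\c&d\end{pmatrix}$ followed by a number $w$ denotes the linear fractional transformation $w\mapsto\frac{aw+b}{cw+d}$ on the Riemann sphere. The conclusion is two identities, one for the upper signs and one for the lower signs. *)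

(* Defs.v *)
From HB Require Import structures.
From mathcomp Require Import all_boot all_order all_algebra.
From mathcomp Require Import all_classical all_reals all_analysis.
From mathcomp Require Import complex.

Set Implicit Arguments.
Unset Strict Implicit.
Unset Printing Implicit Defensive.

Import Order.TTheory GRing.Theory Num.Theory.
Import numFieldNormedType.Exports.

Local Open Scope classical_set_scope.
Local Open Scope ring_scope.
Local Open Scope complex_scope.

(* A bounded Jacobi matrix, given by its coefficient sequences. *)
Record jacobi (R : realType) := Jacobi {
  ja : int -> R;
  jb : int -> R;
  ja_gt0 : forall n, 0 < ja n;
  ja_bounded : bounded_fun ja;
  jb_bounded : bounded_fun jb }.

Section Jacobi.
Context {R : realType}.
Implicit Types (J : jacobi R) (z : R[i]) (u f : int -> R[i]).

Definition tau J u : int -> R[i] := fun n =>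
  (ja J n)%:C * u (n + 1) + (ja J (n - 1))%:C * u (n - 1) + (jb J n)%:C * u n.

Lemma bounded_fun_shift (n : int) (s : int -> R) :
  bounded_fun s -> bounded_fun (fun m => s (m + n)).
Proof.
by move=> [M [Mr HM]]; exists M; split => // x Mx y _; exact: (HM x Mx (y + n)).
Qed.

(* S^n J for n of either sign: the coefficients are (a_{m+n}, b_{m+n})_m. *)
Definition jshift (n : int) J : jacobi R :=
  {| ja := fun m => ja J (m + n);
     jb := fun m => jb J (m + n);
     ja_gt0 := fun m => ja_gt0 J (m + n);
     ja_bounded := bounded_fun_shift n (ja_bounded J);
     jb_bounded := bounded_fun_shift n (jb_bounded J) |}.

Definition mx22 (a b c d : R[i]) : 'M[R[i]]_2 :=
  \matrix_(i, j) if i == 0 then (if j == 0 then a else b)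
                 else (if j == 0 then c else d).

Definition transfer1 z J : 'M[R[i]]_2 :=
  mx22 ((z - (jb J 1)%:C) / (ja J 1)%:C) ((ja J 1)%:C)^-1
       (- (ja J 1)%:C)                   0.

Fixpoint transfer_nat z (n : nat) J : 'M[R[i]]_2 :=
  if n is k.+1 then transfer1 z (jshift k%:Z J) *m transfer_nat z k J
  else 1%:M.

Definition transfer z (n : int) J : 'M[R[i]]_2 :=
  match n with
  | Posz k => transfer_nat z k J
  | Negz k => invmx (transfer_nat z k.+1 (jshift (- k.+1%:Z) J))
  end.

Definition cmod (w : R[i]) : R := complex.Re `|w|.

Definition l2_at_pinfty u : Prop :=
  cvgn (series (fun n : nat => cmod (u n%:Z) ^+ 2)).
Definition l2_at_ninfty u : Prop :=
  cvgn (series (fun n : nat => cmod (u (- n%:Z)) ^+ 2)).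

Definition weyl_solution (l2 : (int -> R[i]) -> Prop) z J : set (int -> R[i]) :=
  [set f | [/\ exists n, f n != 0, forall n, tau J f n = z * f n & l2 f]].

(* For Im z > 0 these solutions exist and are unique up to a factor, which
   does not affect m_plus and m_minus. *)
Definition f_plus z J : int -> R[i] :=
  xget (fun=> 0) (weyl_solution l2_at_pinfty z J).
Definition f_minus z J : int -> R[i] :=
  xget (fun=> 0) (weyl_solution l2_at_ninfty z J).

Definition m_plus z J : R[i] :=
  - (f_plus z J 1 / ((ja J 0)%:C * f_plus z J 0)).
Definition m_minus z J : R[i] :=
  f_minus z J 1 / ((ja J 0)%:C * f_minus z J 0).

(* Some w is the finite point w, and None is the point at infinity. *)
Definition riemann_sphere : Type := one_point_compactification R[i].

Definition lft (A : 'M[R[i]]_2) (w : riemann_sphere) : riemann_sphere :=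
  let: (a, b, c, d) := (A 0 0, A 0 1, A 1 0, A 1 1) in
  match w with
  | Some w => if c * w + d == 0 then None else Some ((a * w + b) / (c * w + d))
  | None => if c == 0 then None else Some (a / c)
  end.

Definition enorm (v : 'cV[R[i]]_2) : R :=
  Num.sqrt (\sum_(i < 2) cmod (v i 0) ^+ 2).

Definition opnorm (A : 'M[R[i]]_2) : R :=
  sup [set enorm (A *m v) | v in [set v | enorm v <= 1]].

End Jacobi.

Arguments riemann_sphere : clear implicits.

(* Main.v *)
Require Import Defs.
From HB Require Import structures.
From mathcomp Require Import all_boot all_order all_algebra.
From mathcomp Require Import all_classical all_reals all_analysis.
From mathcomp Require Import complex.
From mathcomp Require Import ring lra zify.

Set Implicit Arguments.
Unset Strict Implicit.
Unset Printing Implicit Defensive.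

Import Order.TTheory GRing.Theory Num.Theory.
Import numFieldNormedType.Exports.

Local Open Scope classical_set_scope.
Local Open Scope ring_scope.

(** Write [Y n] for the column (f (n+1), - a n * f n) attached to a solution [f]
of [tau f = z f]; transfer matrices move [Y 0] to [Y n], and with
[f = f_plus] or [f = f_minus] the quotient of the two entries of [Y 0] is
[m_plus], respectively [- m_minus].  The theorem therefore says that
[T g J] maps the line of initial states of Weyl solutions of [J] to that of
[act g J].

Let [f] be a Weyl solution of [J] and let [F] be the solution for [act g J]
whose initial state is [T g J *m Y 0].  As the group is abelian, the cocycle
identity for [g + n = n + g] shows that the state of [F] at [n] is
[T g (n . J) *m Y n] ([weyl_slope_lft]).  Since [Y n] is bounded, the
hypothesis on the liminf makes the states of [F] bounded along a sequence of
indices tending to the chosen end.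

This is enough for [F] to be square summable there.  Green's identity
([green]) says that [Im z] times the sum of [|F k|^2] over [1 <= k <= n] is
the difference of the fluxes [a k * Im (F (k+1) * conj (F k))] at [n] and at
[0].  The flux is at most the squared norm of the state, so the partial sums,
which increase with [n], are bounded along a subsequence and hence bounded
([l2_half_of_flux]).

The same identity gives the rest of the Weyl theory that is needed.  The flux
of a square summable solution tends to [0]; if its flux at [0] vanishes as
well, the solution is zero ([half_solution_eq0]).  Hence a Weyl solution
vanishes neither at [0] nor at [1], and two of them are proportional.
Existence ([half_weyl_exists]) is the limit point argument: the solutions
normalized by [f 0 = 1] with a Dirichlet condition at [N] have square sums over
[1 <= k <= N] bounded independently of [N], and their initial slopes accumulate at the slope of a
square summable solution.

Both ends are treated at once.  Reading the sites as 0, 1, 2, ... at the right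
end and as 1, 0, -1, ... at the left end turns either half of the equation into
the same recurrence indexed by natural numbers. *)

(** * Squared modulus and current *)

Section SquaredModulus.
Context {R : realType}.
Implicit Types (w x y z : R[i]) (a b : R).

Definition sqmod w : R := complex.Re w ^+ 2 + complex.Im w ^+ 2.

Lemma cmod_sqr w : cmod w ^+ 2 = sqmod w.
Proof. by rewrite /cmod normc_def /= sqr_sqrtr // addr_ge0 ?sqr_ge0. Qed.

Lemma sqmod_ge0 w : 0 <= sqmod w.
Proof. by rewrite addr_ge0 ?sqr_ge0. Qed.

Lemma sqmod1 : sqmod 1 = 1.
Proof. by rewrite /sqmod /= expr0n expr1n addr0. Qed.

Lemma sqmod_real a : sqmod a%:C%C = a ^+ 2.
Proof. by rewrite /sqmod /= expr0n addr0. Qed.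

Lemma sqmod_eq0 w : (sqmod w == 0) = (w == 0).
Proof.
by case: w => a b; rewrite /sqmod /= paddr_eq0 ?sqr_ge0 // !sqrf_eq0 eq_complex.
Qed.

Lemma sqmodM w x : sqmod (w * x) = sqmod w * sqmod x.
Proof. by case: w x => [a b] [c d]; rewrite /sqmod /=; ring. Qed.

Lemma sqmodD_le w x : sqmod (w + x) <= 2 * sqmod w + 2 * sqmod x.
Proof.
rewrite -subr_ge0 [leRHS](_ : _ = sqmod (w - x)) ?sqmod_ge0 //.
by case: w x => [a b] [c d]; rewrite /sqmod /=; ring.
Qed.

(** The imaginary part of [x] times the conjugate of [y]. *)
Definition current x y : R :=
  complex.Im x * complex.Re y - complex.Re x * complex.Im y.

Lemma sqmodN w : sqmod (- w) = sqmod w.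
Proof. by case: w => a b; rewrite /sqmod /= !sqrrN. Qed.

(** The arithmetic-geometric mean inequality for [x] and [a * y]; attaching the
weight [a] to the second argument makes the right-hand side the squared norm of
a state vector. *)
Lemma current_le a x y :
  0 <= a -> a * current x y <= sqmod x + a ^+ 2 * sqmod y.
Proof.
case: x y => [x1 x2] [y1 y2] a0; rewrite /current /sqmod /=.
have := sqr_ge0 (x2 - a * y1); have := sqr_ge0 (x1 + a * y2).
have := sqr_ge0 x1; have := sqr_ge0 x2.
by have := sqr_ge0 (a * y1); have := sqr_ge0 (a * y2); lra.
Qed.

Lemma currentNC x y : current x (- y) = current y x.
Proof. by case: x y => [x1 x2] [y1 y2]; rewrite /current /=; ring. Qed.

Lemma current0l x : current 0 x = 0.
Proof. by rewrite /current /= !mul0r subrr. Qed.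

Lemma current0r x : current x 0 = 0.
Proof. by rewrite /current /= !mulr0 subrr. Qed.

(** Multiply the recurrence by the conjugate of [x1] and take imaginary parts:
the real potential disappears, and the neighbouring terms become the outgoing
and the incoming flux. *)
Lemma green_step z x0 x1 x2 (a0 a1 b : R) :
  a1%:C%C * x2 + a0%:C%C * x0 + b%:C%C * x1 = z * x1 ->
  complex.Im z * sqmod x1 = a1 * current x2 x1 - a0 * current x1 x0.
Proof.
case: z x0 x1 x2 => [z1 z2] [r0 i0] [r1 i1] [r2 i2].
rewrite /sqmod /current /= => -[eR eI].
have := congr1 (fun t => i1 * t) eR; have := congr1 (fun t => r1 * t) eI.
by move=> /= h1 h2; lra.
Qed.

End SquaredModulus.

(** * Nonnegative series and lower limits *)

Lemma nneg_series_cvgP {R : realType} (g : nat -> R) : (forall n, 0 <= g n) ->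
  (exists C : R, forall n, \sum_(k < n) g k <= C) <-> cvgn (series g).
Proof.
move=> g0.
have nd : nondecreasing_seq (series g).
  by apply: nondecreasing_series => n _ _; exact: g0.
split=> [[C hC]|hg].
  apply: nondecreasing_is_cvgn nd _.
  by exists C => _ [n _ <-]; rewrite /series /= big_mkord; exact: hC.
exists (limn (series g)) => n.
by rewrite -(big_mkord xpredT) (nondecreasing_cvgn_le nd hg).
Qed.

Lemma limn_einf_lty {R : realType} (x : nat -> R) :
  (limn_einf (fun n => (x n)%:E) < +oo)%E ->
  exists C : R, forall N, exists2 n, (N <= n)%N & x n <= C.
Proof.
set u := fun n => (x n)%:E; rewrite limn_einf_lim => hl.
have [C hC] : exists C : R, (limn (einfs u) < C%:E)%E.
  move: hl; case: (limn _) => [r| |] // _; last by exists 0; exact: ltNyr.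
  by exists (r + 1); rewrite lte_fin ltrDl.
exists C => N.
have /le_lt_trans/(_ hC)/ereal_inf_lt[_ [n /= Nn <-]] :
    (einfs u N <= limn (einfs u))%E.
  rewrite (cvg_lim _ (@cvg_einfs_sup _ u)) //.
  by apply: ereal_sup_ubound; exists N.
by rewrite lte_fin => /ltW xC; exists n.
Qed.
(** * Solutions on a half-line *)

Section HalfLine.
Context {R : realType}.
Variables (a b : nat -> R) (z : R[i]) (A : R).
Hypotheses (a_gt0 : forall n, 0 < a n) (aA : forall n, a n <= A).
Hypothesis z_upper : 0 < complex.Im z.
Implicit Types f u v : nat -> R[i].

Definition half_solution f : Prop := forall n,
  (a n.+1)%:C%C * f n.+2 + (a n)%:C%C * f n + (b n)%:C%C * f n.+1 = z * f n.+1.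

(** The entry [f 0] is left out because the recurrence is centred at the sites
[n.+1]; these are the terms that Green's identity controls. *)
Definition mass f (n : nat) : R := \sum_(k < n) sqmod (f k.+1).

Definition l2_half f : Prop := exists C : R, forall n, mass f n <= C.

Definition flux f (n : nat) : R := a n * current (f n.+1) (f n).

Lemma mass_ge0 f n : 0 <= mass f n.
Proof. by apply: sumr_ge0 => k _; exact: sqmod_ge0. Qed.

Lemma mass_mono f m n : (m <= n)%N -> mass f m <= mass f n.
Proof.
move=> /subnK <-; elim: (n - m)%N => // k; rewrite addSn => IH.
by rewrite (le_trans IH) // {2}/mass big_ord_recr /= lerDl sqmod_ge0.
Qed.

Lemma half_solution_comb f u (c d : R[i]) :
  half_solution f -> half_solution u ->
  half_solution (fun n => c * f n + d * u n).
Proof.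
move=> hf hu n.
transitivity (c * (z * f n.+1) + d * (z * u n.+1)); last by ring.
by rewrite -hf -hu; ring.
Qed.

Lemma l2_half_comb f u (c d : R[i]) : l2_half f -> l2_half u ->
  l2_half (fun n => c * f n + d * u n).
Proof.
move=> [C hC] [D hD]; exists (2 * (sqmod c * C) + 2 * (sqmod d * D)) => n.
apply: (@le_trans _ _ (2 * (sqmod c * mass f n) + 2 * (sqmod d * mass u n))).
  rewrite /mass !mulr_sumr -big_split; apply: ler_sum => k _.
  by rewrite -!sqmodM; exact: sqmodD_le.
by rewrite lerD // ler_pM2l // ler_wpM2l ?sqmod_ge0.
Qed.

Lemma green f n : half_solution f ->
  complex.Im z * mass f n = flux f n - flux f 0.
Proof.
move=> hf; elim: n => [|n IH]; first by rewrite /mass big_ord0 mulr0 subrr.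
rewrite /mass big_ord_recr mulrDr -/(mass f n) IH.
by rewrite (green_step (hf n)) /flux; ring.
Qed.

(** The mass is monotone, so a bound along a subsequence bounds it everywhere.
This is where a finite liminf, rather than a bound on all the norms, is
enough. *)
Lemma l2_half_of_flux f (C : R) : half_solution f ->
  (forall N, exists2 n, (N <= n)%N & flux f n <= C) -> l2_half f.
Proof.
move=> hf hC; exists ((C - flux f 0) / complex.Im z) => N.
have [n Nn hn] := hC N; rewrite (le_trans (mass_mono f Nn)) //.
by rewrite ler_pdivlMr // mulrC green // lerD2r.
Qed.

Lemma l2_halfP f :
  l2_half f <-> cvgn (series (fun n => sqmod (f n.+1))).
Proof. by rewrite -nneg_series_cvgP // => n; exact: sqmod_ge0. Qed.

Lemma l2_half_cvg0 f (e : R) : l2_half f -> 0 < e ->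
  exists N, forall n, (N <= n)%N -> sqmod (f n.+1) < e.
Proof.
move=> /l2_halfP /cvg_series_cvg_0 /cvgrPdist_lt hf /hf [N _ hN].
exists N => n Nn.
by have := hN n Nn; rewrite /= sub0r normrN ger0_norm // sqmod_ge0.
Qed.

Lemma l2_half_bounded f : l2_half f ->
  exists C : R, forall n, sqmod (f n) <= C.
Proof.
move=> [C hC].
have hS n : sqmod (f n.+1) <= C.
  apply: le_trans (hC n.+1); rewrite /mass big_ord_recr /=.
  by rewrite lerDr; exact: mass_ge0.
exists (C + sqmod (f 0)) => -[|n].
  by rewrite lerDr (le_trans _ (hS 0)) ?sqmod_ge0.
by rewrite (le_trans (hS n)) // lerDl sqmod_ge0.
Qed.

Lemma l2_half_flux_lt f (e : R) : l2_half f -> 0 < e ->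
  exists N, forall n, (N <= n)%N -> flux f n < e.
Proof.
move=> hl e0; have A0 : 0 < A := lt_le_trans (a_gt0 0) (aA 0).
have k0 : 0 < 1 + A ^+ 2 by rewrite addr_gt0 // exprn_gt0.
have d0 : 0 < e / (1 + A ^+ 2) by rewrite divr_gt0.
have [N hN] := l2_half_cvg0 hl d0; exists N.+1 => -[//|n] Nn.
have h1 := hN n Nn; have h2 := hN n.+1 (leqW Nn).
have : flux f n.+1 <= sqmod (f n.+2) + A ^+ 2 * sqmod (f n.+1).
  apply: le_trans (current_le _ _ (ltW (a_gt0 _))) _; rewrite lerD2l.
  by rewrite ler_wpM2r ?sqmod_ge0 // ler_pXn2r // nnegrE ltW.
move=> /le_lt_trans; apply.
have -> : e = e / (1 + A ^+ 2) + A ^+ 2 * (e / (1 + A ^+ 2)).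
  by rewrite -[X in X + _]mul1r -mulrDl mulrC divfK // lt0r_neq0.
by rewrite ltrD // ltr_pM2l // exprn_gt0.
Qed.

(** By Green's identity the flux is at least [Im z] times the mass once its
initial value is nonnegative; as it becomes arbitrarily small, the mass is zero. *)
Lemma half_solution_eq0 f : half_solution f -> l2_half f ->
  0 <= flux f 0 -> forall n, f n = 0.
Proof.
move=> hf hl w0.
have m0 n : mass f n <= 0.
  rewrite -(pmulr_rle0 _ z_upper); rewrite leNgt; apply/negP => e0.
  have [N hN] := l2_half_flux_lt hl e0.
  have := hN (maxn n N) (leq_maxr _ _).
  rewrite -[X in X < _](subrK (flux f 0)) -green // ltNge => /negP [].
  rewrite (@le_trans _ _ (complex.Im z * mass f (maxn n N))) ?lerDl //.
  by rewrite ler_pM2l // mass_mono // leq_maxl.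
have f0 n : f n.+1 = 0.
  apply/eqP; rewrite -sqmod_eq0 eq_le sqmod_ge0 andbT.
  apply: le_trans (m0 n.+1); rewrite /mass big_ord_recr /=.
  by rewrite lerDr; exact: mass_ge0.
(* The recurrence at the first site recovers the entry not seen by the mass. *)
case=> //; have := hf 0; rewrite !f0 !mulr0 add0r addr0 => /eqP.
rewrite mulf_eq0 => /orP[/eqP [h]|/eqP//].
by have := a_gt0 0; rewrite h ltxx.
Qed.

(** The solutions [u] and [v] form the basis with initial values (1, 0) and
(0, 1), so [u + c * v] has slope [c].  Weyl's argument with the Dirichlet
slopes [c n]: their masses are bounded uniformly in [n], and the bound passes,
up to a constant, to any accumulation point of the slopes. *)
Lemma half_weyl_exists u v : half_solution u -> half_solution v ->
  u 0 = 1 -> u 1%N = 0 -> v 0 = 0 -> v 1%N = 1 ->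
  exists w : R[i], l2_half (fun n => u n + w * v n).
Proof.
move=> hu hv u0 u1 v0 v1.
pose f (c : R[i]) n := u n + c * v n.
have hf c : half_solution (f c).
  move=> n; have := half_solution_comb 1 c hu hv n.
  by rewrite /f !mul1r.
(* Two Dirichlet conditions would make every flux vanish, hence the mass. *)
have vN0 n : v n.+2 != 0.
  apply/eqP => vn; have := green n.+1 hv.
  rewrite /flux vn v0 current0l current0r !mulr0 subrr => /eqP.
  rewrite mulf_eq0 (gt_eqF z_upper) /= => /eqP m0.
  have := mass_mono v (ltn0Sn n).
  by rewrite m0 /mass big_ord_recl big_ord0 v1 sqmod1 addr0 ler10.
(* The slope for which the combination vanishes at the site [n.+2]. *)
pose c n := - (u n.+2 / v n.+2).
pose B := a 0 / complex.Im z.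
have B0 : 0 < B by rewrite divr_gt0.
have mE n : complex.Im z * mass (f (c n)) n.+1 = - (a 0 * complex.Im (c n)).
  rewrite green // /flux /f u0 u1 v0 v1 mulr0 mulr1 add0r addr0.
  have -> : u n.+2 + c n * v n.+2 = 0 by rewrite /c mulNr divfK ?subrr.
  by rewrite current0l /current /=; ring.
have mB n : mass (f (c n)) n.+1 <= B * `|complex.Im (c n)|.
  rewrite /B mulrAC ler_pdivlMr // mulrC mE -mulrN ler_pM2l //.
  by rewrite -normrN ler_norm.
(* The first term of the mass is the squared modulus of the slope, so the
   estimate [mB] bounds the slope as well. *)
have cm n : sqmod (c n) <= mass (f (c n)) n.+1.
  have := mass_mono (f (c n)) (ltn0Sn n).
  by rewrite {1}/mass big_ord_recl big_ord0 /f u1 v1 mulr1 add0r addr0.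
have cI n : `|complex.Im (c n)| <= B.
  have := le_trans (cm n) (mB n); rewrite /sqmod => h.
  have h2 : `|complex.Im (c n)| ^+ 2 <= B * `|complex.Im (c n)|.
    by rewrite real_normK ?num_real // (le_trans _ h) // lerDr sqr_ge0.
  have := normr_ge0 (complex.Im (c n)); rewrite le_eqVlt => /orP[/eqP <-|n0].
    exact: ltW.
  by move: h2; rewrite expr2 ler_pM2r.
have mB2 n : mass (f (c n)) n.+1 <= B ^+ 2.
  by rewrite (le_trans (mB n)) // expr2 ler_pM2l.
have cR n : `|complex.Re (c n)| <= B.
  rewrite -(@ler_pXn2r _ 2) ?nnegrE ?(ltW B0) // real_normK ?num_real //.
  rewrite (le_trans _ (mB2 n)) // (le_trans _ (cm n)) //.
  by rewrite /sqmod lerDl sqr_ge0.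
have bnd (s : nat -> R) : (forall n, `|s n| <= B) -> bounded_fun s.
  move=> sB; exists B; split=> [|x Bx n _]; first exact: num_real.
  exact: le_trans (sB n) (ltW Bx).
have [i1 mi1 ci1] := bolzano_weierstrass (bnd _ cR).
have [i2 mi2 ci2] := bolzano_weierstrass (bnd _ (fun n => cI (i1 n))).
pose i := i1 \o i2.
have inc_ge (s : nat -> nat) : increasing_seq s -> forall m, (m <= s m)%N.
  move=> /increasing_seqP hs; elim=> // m IH.
  by apply: leq_ltn_trans IH (hs m).
have inc n : (n <= i n)%N by rewrite (leq_trans (inc_ge _ mi2 n)) // inc_ge.
have ciR : cvgn (fun n => complex.Re (c (i n))).
  have i2oo : i2 @ \oo --> \oo.
    move=> P [N _ hN]; exists N => // n Nn.
    by apply: hN; exact: leq_trans Nn (inc_ge _ mi2 n).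
  exact: cvgP (cvg_comp _ _ i2oo ci1).
pose w : R[i] := (limn (fun n => complex.Re (c (i n))) +i*
                  limn (fun n => complex.Im (c (i n))))%C.
exists w, (2 * B ^+ 2 + 4) => m.
(* For a fixed truncation [m], choose an index whose slope is so close to [w]
   that the error, of size [e ^+ 2 * mass v m], is at most 1. *)
pose e : R := (1 + mass v m)^-1.
have e1 : 0 < 1 + mass v m by rewrite ltr_pwDl // mass_ge0.
have e0 : 0 < e by rewrite invr_gt0.
have [N1 _ hN1] := (cvgrPdist_lt _ _).1 ciR e e0.
have [N2 _ hN2] := (cvgrPdist_lt _ _).1 ci2 e e0.
pose n := maxn m (maxn N1 N2).
have {hN1} hR := hN1 n (leq_trans (leq_maxl _ _) (leq_maxr _ _)).
have {hN2} hI := hN2 n (leq_trans (leq_maxr _ _) (leq_maxr _ _)).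
have hw : sqmod (w - c (i n)) <= 2 * e ^+ 2.
  rewrite /sqmod mulr_natl mulr2n lerD //.
    rewrite -real_normK ?num_real // ler_pXn2r ?nnegrE ?(ltW e0) //.
    by apply: ltW; case: (c _) hR.
  rewrite -real_normK ?num_real // ler_pXn2r ?nnegrE ?(ltW e0) //.
  by apply: ltW; move: hI; rewrite /i /=; case: (c _).
have : mass (f w) m <=
    2 * mass (f (c (i n))) m + 2 * (sqmod (w - c (i n)) * mass v m).
  rewrite /mass !mulr_sumr -big_split; apply: ler_sum => k _.
  rewrite -sqmodM.
  have -> : f w k.+1 = f (c (i n)) k.+1 + (w - c (i n)) * v k.+1.
    by rewrite /f; ring.
  exact: sqmodD_le.
move/le_trans; apply; rewrite lerD ?ler_pM2l //.
  apply: le_trans (mB2 (i n)); apply: mass_mono.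
  exact: leq_trans (leq_maxl m _) (leq_trans (inc n) (leqnSn _)).
rewrite -[leRHS]/(2 * 2)%:R natrM ler_pM2l //.
apply: le_trans (ler_wpM2r (mass_ge0 _ _) hw) _.
have ev : e * mass v m <= 1.
  by rewrite mulrC ler_pdivrMr // mul1r lerDr.
have el : e <= 1 by rewrite invf_le1 // lerDl mass_ge0.
rewrite -mulrA ger_pMr // expr2 -mulrA mulr_ile1 ?mulr_ge0 ?mass_ge0 // ltW //.
Qed.

End HalfLine.
(** * Vectors of length two and operator norms *)

Section PlaneVectors.
Context {R : realType}.
Implicit Types (A B : 'M[R[i]]_2) (v w : 'cV[R[i]]_2).

Lemma ord2P (P : 'I_2 -> Prop) : P 0 -> P 1 -> forall i, P i.
Proof.
move=> P0 P1 [[|[|//]] hi]; [move: P0 | move: P1];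
  by congr (P _); apply: val_inj.
Qed.

Lemma cV2P v w : v 0 0 = w 0 0 -> v 1 0 = w 1 0 -> v = w.
Proof. by move=> h0 h1; apply/colP; apply: ord2P. Qed.

Lemma mulmx2E A v i : (A *m v) i 0 = A i 0 * v 0 0 + A i 1 * v 1 0.
Proof.
rewrite mxE !big_ord_recl big_ord0 addr0.
by rewrite (_ : lift ord0 ord0 = 1) //; apply: val_inj.
Qed.

Lemma enorm_ge0 v : 0 <= enorm v.
Proof. exact: sqrtr_ge0. Qed.

Lemma enorm_sqr v : enorm v ^+ 2 = sqmod (v 0 0) + sqmod (v 1 0).
Proof.
rewrite sqr_sqrtr; last by apply: sumr_ge0 => i _; exact: sqr_ge0.
rewrite !big_ord_recl big_ord0 addr0 !cmod_sqr.
by rewrite (_ : lift ord0 ord0 = 1) //; apply: val_inj.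
Qed.

Lemma enorm_eq0 v : enorm v = 0 -> v = 0.
Proof.
move=> v0; have /eqP := enorm_sqr v.
rewrite v0 expr0n eq_sym paddr_eq0 ?sqmod_ge0 // !sqmod_eq0.
by move=> /andP[/eqP h0 /eqP h1]; apply: cV2P; rewrite mxE.
Qed.

Lemma enormZ (c : R) v : 0 <= c -> enorm (c%:C%C *: v) = c * enorm v.
Proof.
move=> c0; have cv0 : 0 <= c * enorm v by rewrite mulr_ge0 ?enorm_ge0.
apply: (@pexpIrn _ 2); rewrite ?nnegrE ?enorm_ge0 //=.
by rewrite exprMn !enorm_sqr !mxE !sqmodM !sqmod_real -mulrDr.
Qed.

(** [opnorm] is a supremum, which is meaningful only for a set bounded above; an
entrywise estimate gives such a bound. *)
Lemma enorm_mulmx A v : enorm (A *m v) <= opnorm A * enorm v.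
Proof.
have ub : has_sup [set enorm (A *m v) | v in [set v | enorm v <= 1]].
  split.
    exists (enorm (A *m 0)), 0 => //=.
    by rewrite -(scale0r 0) -[0]/((0 : R)%:C%C) enormZ // mul0r.
  exists (1 + \sum_(i < 2) (2 * sqmod (A i 0) + 2 * sqmod (A i 1))).
  move=> _ [w /= w1 <-].
  have w2 : sqmod (w 0 0) + sqmod (w 1 0) <= 1.
    by rewrite -enorm_sqr expr_le1 ?enorm_ge0.
  have h0 : sqmod (w 0 0) <= 1 by rewrite (le_trans _ w2) // lerDl sqmod_ge0.
  have h1 : sqmod (w 1 0) <= 1 by rewrite (le_trans _ w2) // lerDr sqmod_ge0.
  have hS : enorm (A *m w) ^+ 2 <=
      \sum_(i < 2) (2 * sqmod (A i 0) + 2 * sqmod (A i 1)).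
    rewrite sqr_sqrtr; last by apply: sumr_ge0 => i _; exact: sqr_ge0.
    apply: ler_sum => i _; rewrite cmod_sqr mulmx2E.
    rewrite (le_trans (sqmodD_le _ _)) // !sqmodM lerD // ler_pM2l //.
      by rewrite ler_piMr ?sqmod_ge0.
    by rewrite ler_piMr ?sqmod_ge0.
  have := enorm_ge0 (A *m w); set x := enorm _ in hS *.
  (* The bound is on the square, and [x <= 1 + x ^+ 2]. *)
  by move: (\sum_(_ < 2) _) hS => S hS x0; have := sqr_ge0 (x - 1); nra.
have [v0|vN0] := eqVneq (enorm v) 0.
  by rewrite (enorm_eq0 v0) mulmx0 -(enorm_eq0 v0) v0 mulr0.
have v_gt0 : 0 < enorm v by rewrite lt_neqAle eq_sym vN0 enorm_ge0.
rewrite -ler_pdivrMr // mulrC -enormZ ?invr_ge0 ?enorm_ge0 // scalemxAr.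
apply: ub_le_sup; first exact: ub.2.
exists ((enorm v)^-1%:C%C *: v) => //=.
by rewrite enormZ ?invr_ge0 ?enorm_ge0 // mulVf.
Qed.

Lemma mulmx_eq0_det1 B v : \det B = 1 -> B *m v = 0 -> v = 0.
Proof.
move=> dB Bv; have uB : B \in unitmx by rewrite unitmxE dB unitr1.
by rewrite -(mulKmx uB v) Bv mulmx0.
Qed.

End PlaneVectors.

(** * Transfer matrices and solutions on the whole line *)

Section Transfer.
Context {R : realType}.
Implicit Types (J : jacobi R) (z : R[i]) (f : int -> R[i]) (v : 'cV[R[i]]_2).

(** Coefficients determine the record by proof irrelevance; this is what turns
the group law of the shifts into equalities between Jacobi matrices. *)
Lemma jacobi_ext J J' : ja J = ja J' -> jb J = jb J' -> J = J'.
Proof.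
case: J J' => [a b ga Ba Bb] [a' b' ga' Ba' Bb'] /= ea eb.
by case: _ / ea ga' Ba' => ga' Ba'; case: _ / eb Bb' => Bb';
  congr Jacobi; exact: Prop_irrelevance.
Qed.

Lemma jshift0 J : jshift 0 J = J.
Proof. by apply: jacobi_ext; apply/funext => n /=; rewrite addr0. Qed.

Lemma jshiftD m n J : jshift m (jshift n J) = jshift (m + n) J.
Proof. by apply: jacobi_ext; apply/funext => k /=; rewrite addrA. Qed.

Lemma ja_neq0 J n : (ja J n)%:C%C != 0.
Proof. by rewrite fmorph_eq0 gt_eqF // ja_gt0. Qed.

Lemma transfer1_unit z J : transfer1 z J \in unitmx.
Proof.
have a0 := ja_neq0 J 1.
(* The adjugate: the determinant is 1. *)
pose B := mx22 0 (- ((ja J 1)%:C%C)^-1)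
  ((ja J 1)%:C%C) ((z - (jb J 1)%:C%C) / (ja J 1)%:C%C).
apply: (@mulmx1_unit _ _ _ B _).1.
apply/matrixP; apply: ord2P; apply: ord2P;
  by rewrite mxE !big_ord_recl big_ord0 !mxE /=; field; rewrite ?a0.
Qed.

Lemma transfer_nat_unit z n J : transfer_nat z n J \in unitmx.
Proof.
by elim: n => [|n IH] /=; rewrite ?unitmx1 // unitmx_mul transfer1_unit.
Qed.

Lemma transfer_nat_recr z n J :
  transfer_nat z n.+1 J = transfer_nat z n (jshift 1 J) *m transfer1 z J.
Proof.
elim: n => [|n IH]; first by rewrite /= jshift0 mulmx1 mul1mx.
rewrite -[LHS]/(transfer1 z (jshift n.+1%:Z J) *m transfer_nat z n.+1 J).
by rewrite IH mulmxA /= jshiftD [n.+1%:Z]intS addrC.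
Qed.

(** One recursion for all integers: in the negative range the inverse of a
product peels off its last factor, which is why the products over natural
numbers are also expanded on the right. *)
Lemma transferS z n J :
  transfer z (n + 1) J = transfer1 z (jshift n J) *m transfer z n J.
Proof.
case: n => [n|[|n]].
- by rewrite (_ : Posz n + 1 = Posz n.+1) //; lia.
- rewrite (_ : Negz 0 + 1 = Posz 0) // [LHS]/= /transfer.
  rewrite [transfer_nat _ _ _]/= jshift0 mulmx1.
  by rewrite mulmxV // transfer1_unit.
- rewrite (_ : Negz n.+1 + 1 = Negz n); last by lia.
  rewrite /transfer [X in _ = _ *m invmx X]transfer_nat_recr jshiftD.
  rewrite (_ : 1 + - _ = - n.+1%:Z :> int); last by lia.
  rewrite -[Negz n.+1]/(- n.+2%:Z); set K := jshift (- n.+2%:Z) J.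
  set L := transfer_nat _ _ _.
  have -> : invmx (L *m transfer1 z K) = invmx (transfer1 z K) *m invmx L.
    exact: (@invrM _ L (transfer1 z K) (transfer_nat_unit _ _ _)
              (transfer1_unit _ _)).
  by rewrite mulmxA mulmxV ?mul1mx // transfer1_unit.
Qed.

(** The sign and the weight of the second entry are those that make [transfer1]
the one-step propagator and that bound the flux by the squared norm. *)
Definition state J f (n : int) : 'cV[R[i]]_2 :=
  \col_i (if i == 0 then f (n + 1) else - (ja J n)%:C%C * f n).

Definition solution z J f : Prop := forall n, tau J f n = z * f n.

Lemma state_step z J f n : solution z J f ->
  state J f (n + 1) = transfer1 z (jshift n J) *m state J f n.
Proof.
move=> hf; have := hf (n + 1); have a1 := ja_neq0 J (n + 1).
rewrite /tau addrK => h.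
apply: cV2P; rewrite mulmx2E !mxE /= [1 + n]addrC; last by rewrite mul0r addr0.
apply: (mulfI a1); move: h.
set x := f (n + 1 + 1); set y := f n; set w := f (n + 1) => h.
have -> : (ja J (n + 1))%:C%C * x =
    z * w - (ja J n)%:C%C * y - (jb J (n + 1))%:C%C * w.
  by rewrite -h; ring.
by field.
Qed.

Lemma state_transfer z J f n : solution z J f ->
  state J f n = transfer z n J *m state J f 0.
Proof.
move=> hf; elim: n => [|n IH|n IH]; first by rewrite /transfer /= mul1mx.
  rewrite -[n.+1]addn1 PoszD transferS -mulmxA -IH.
  exact: state_step.
have E : - n.+1%:Z + 1 = - n%:Z by lia.
move: IH; rewrite -E transferS (state_step _ hf) -mulmxA.
move=> /(congr1 (mulmx (invmx (transfer1 z (jshift (- n.+1%:Z) J))))).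
by rewrite !mulKmx ?transfer1_unit.
Qed.

Lemma solution_exists z J v : exists2 f, solution z J f & state J f 0 = v.
Proof.
(* The first entry of the state at [n - 1] is the value at [n]. *)
pose f n := (transfer z (n - 1) J *m v) 0 0.
have fE n : state J f n = transfer z n J *m v.
  apply: cV2P; rewrite [LHS]mxE /= /f ?addrK //.
  rewrite -[in RHS](subrK 1 n) transferS -mulmxA [RHS]mulmx2E.
  rewrite [transfer1 _ _ 1 0]mxE [transfer1 _ _ 1 1]mxE /=.
  by rewrite mul0r addr0 [1 + _]addrC subrK.
exists f; last by rewrite fE /transfer /= mul1mx.
move=> n; have := fE n; rewrite -[n in RHS](subrK 1 n) transferS -mulmxA -fE.
move=> /(congr1 (fun w : 'cV_2 => w 0 0)).
rewrite mulmx2E !mxE /= [1 + _]addrC !subrK => h.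
have a0 := ja_neq0 J n.
by rewrite /tau h; field.
Qed.

End Transfer.

(** * Weyl solutions at either end *)

Section Ends.
Context {R : realType}.
Variables (z : R[i]) (z_upper : 0 < complex.Im z) (left : bool).
Implicit Types (J : jacobi R) (f h : int -> R[i]).

(** The edge between 0 and 1 belongs to both half-lines: [cut 0] is its index in
either case, and [site] starts with its two endpoints in the order in which the
half-line meets them.  The state at [cut n] carries the values at [site n] and
[site n.+1], the latter first at the right end and second at the left end. *)
Definition cut (n : nat) : int := if left then - n%:Z else n%:Z.
Definition site (n : nat) : int := if left then 1 - n%:Z else n%:Z.

Definition end_coef J (n : nat) : R := ja J (cut n).
Definition end_pot J (n : nat) : R := jb J (if left then - n%:Z else n.+1%:Z).

Definition l2_end : (int -> R[i]) -> Prop :=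
  if left then l2_at_ninfty else l2_at_pinfty.

Definition weyl J f : Prop := weyl_solution l2_end z J f.

Lemma end_coef_gt0 J n : 0 < end_coef J n.
Proof. exact: ja_gt0. Qed.

Lemma end_coef_bounded J : exists A : R, forall n, end_coef J n <= A.
Proof.
have [M [Mr HM]] := ja_bounded J; exists (M + 1) => n.
by apply: le_trans (ler_norm _) (HM (M + 1) _ _ I); rewrite ltrDl.
Qed.

Lemma solution_half J f : solution z J f ->
  half_solution (end_coef J) (end_pot J) z (f \o site).
Proof.
move=> hf n; rewrite /end_coef /end_pot /cut /site /=; case: left.
  have := hf (- n%:Z).
  rewrite /tau (_ : - n%:Z + 1 = 1 - n%:Z); last by lia.
  rewrite (_ : 1 - n.+1%:Z = - n%:Z); last by lia.
  rewrite (_ : 1 - n.+2%:Z = - n%:Z - 1); last by lia.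
  rewrite (_ : - n.+1%:Z = - n%:Z - 1); last by lia.
  by move=> <-; ring.
have := hf n.+1%:Z; rewrite /tau (_ : n.+1%:Z + 1 = n.+2%:Z); last by lia.
by rewrite (_ : n.+1%:Z - 1 = n%:Z); last by lia.
Qed.

Lemma l2_halfE f : l2_half (f \o site) <-> l2_end f.
Proof.
rewrite l2_halfP /l2_end /l2_at_ninfty /l2_at_pinfty /site /=; case: left => /=.
  suff -> : (fun n : nat => sqmod (f (1 - n.+1%:Z))) =
            (fun n : nat => cmod (f (- n%:Z)) ^+ 2) by [].
  by apply/funext => n; rewrite cmod_sqr (_ : 1 - n.+1%:Z = - n%:Z) //; lia.
rewrite -!nneg_series_cvgP; [|by move=> n; rewrite ?cmod_sqr sqmod_ge0..].
under [X in _ <-> X]eq_exists do under eq_forall do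
  under eq_bigr do rewrite cmod_sqr.
(* At the right end [l2_at_pinfty] counts the value at 0, the mass does not. *)
split=> -[C hC].
  exists (sqmod (f 0) + C) => -[|n].
    by rewrite big_ord0 addr_ge0 ?sqmod_ge0 // (le_trans _ (hC 0)) ?big_ord0.
  by rewrite big_ord_recl lerD2l; exact: hC.
exists C => n; apply: le_trans (hC n.+1).
by rewrite big_ord_recl lerDr sqmod_ge0.
Qed.

Lemma solution_comb J f h (c d : R[i]) : solution z J f -> solution z J h ->
  solution z J (fun n => c * f n + d * h n).
Proof.
move=> hf hh n; transitivity (c * (z * f n) + d * (z * h n)); last by ring.
by rewrite -hf -hh /tau; ring.
Qed.

Lemma solution_exists_values J x y :
  exists f, [/\ solution z J f, f 0 = x & f 1 = y].
Proof.
have [f hf sf] := solution_exists z J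
  (\col_i (if i == 0 then y else - (ja J 0)%:C%C * x)).
exists f; split=> //.
  have := congr1 (fun v : 'cV_2 => v 1 0) sf; rewrite !mxE /=.
  by apply: mulfI; rewrite oppr_eq0 ja_neq0.
by have := congr1 (fun v : 'cV_2 => v 0 0) sf; rewrite !mxE /= add0r.
Qed.

Lemma solution_eq0 J f :
  solution z J f -> f 0 = 0 -> f 1 = 0 -> forall n, f n = 0.
Proof.
move=> hf f0 f1 n; rewrite -[n](subrK 1).
have s0 : state J f 0 = 0 by apply: cV2P; rewrite !mxE /= ?f0 ?mulr0 // add0r.
have := state_transfer (n - 1) hf; rewrite s0 mulmx0.
by move=> /(congr1 (fun v : 'cV_2 => v 0 0)); rewrite !mxE.
Qed.

Lemma weyl_exists J : exists f, weyl J f.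
Proof.
have sites : site 0 = left%:Z /\ site 1 = (~~ left)%:Z.
  by rewrite /site; case: left.
have vals x y : exists f, [/\ solution z J f, f (site 0) = x & f (site 1) = y].
  rewrite sites.1 sites.2; case: left.
    by have [f [hf f0 f1]] := solution_exists_values J y x; exists f.
  by have [f [hf f0 f1]] := solution_exists_values J x y; exists f.
have [u [hu u0 u1]] := vals 1 0; have [v [hv v0 v1]] := vals 0 1.
have [w hw] := half_weyl_exists (end_coef_gt0 J) z_upper
  (solution_half hu) (solution_half hv) u0 u1 v0 v1.
have hf := solution_comb 1 w hu hv.
exists (fun n => 1 * u n + w * v n); split=> //.
  by exists (site 0); rewrite u0 v0 mulr0 addr0 mul1r oner_eq0.
apply/l2_halfE; move: hw; congr l2_half; apply/funext => n /=.
by rewrite mul1r.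
Qed.

(** Vanishing at either endpoint of the edge kills the flux through it,
whichever end the half-line leads to. *)
Lemma end_solution_eq0 J f : solution z J f -> l2_end f ->
  f 0 = 0 \/ f 1 = 0 -> forall n, f n = 0.
Proof.
move=> hf /l2_halfE lf f01; have [A hA] := end_coef_bounded J.
have h := half_solution_eq0 (end_coef_gt0 J) hA z_upper (solution_half hf) lf.
have {h} hz n : f (site n) = 0.
  apply: h; rewrite /flux /= /site; case: left f01 => /= -[] ->;
    by rewrite ?current0l ?current0r mulr0.
have := hz 0; have := hz 1%N; rewrite /site; case: left => h1 h0.
  by apply: solution_eq0 hf _ _.
by apply: solution_eq0 hf _ _.
Qed.

Lemma weyl_neq0 J f : weyl J f -> f 0 != 0 /\ f 1 != 0.
Proof.
case=> [[n fn] hf lf].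
by split; apply: contraNneq fn => f0;
  rewrite (end_solution_eq0 hf lf) ?f0; auto.
Qed.

(** The combination of [f] and [h] that vanishes at 0 is again square summable,
hence zero; its value at 1 is the difference of the two sides. *)
Lemma weyl_unique J f h : weyl J f -> weyl J h -> f 0 * h 1 = h 0 * f 1.
Proof.
move=> [_ hf lf] [_ hh lh].
have hk := solution_comb (- h 0) (f 0) hf hh.
have lk : l2_end (fun n => - h 0 * f n + f 0 * h n).
  apply/l2_halfE; apply: (@l2_half_comb _ (f \o site) (h \o site));
    exact/l2_halfE.
have k0 : - h 0 * f 0 + f 0 * h 0 = 0 by ring.
have := end_solution_eq0 hk lk (or_introl k0) 1.
by move=> /eqP; rewrite mulNr addrC subr_eq0 => /eqP.
Qed.

Lemma enorm_state_sqr J f n :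
  enorm (state J f n) ^+ 2 = sqmod (f (n + 1)) + ja J n ^+ 2 * sqmod (f n).
Proof. by rewrite enorm_sqr !mxE /= mulNr sqmodN sqmodM sqmod_real. Qed.

Lemma flux_le_state J f n :
  flux (end_coef J) (f \o site) n <= enorm (state J f (cut n)) ^+ 2.
Proof.
rewrite enorm_state_sqr /flux /end_coef /site /cut /=.
have := ltW (ja_gt0 J (cut n)); rewrite /cut; case: left => a0.
  rewrite (_ : 1 - n.+1%:Z = - n%:Z); last by lia.
  rewrite (_ : - n%:Z + 1 = 1 - n%:Z); last by lia.
  (* Reversing the order of the endpoints changes the sign of the current and
     moves the weight to the other one. *)
  by rewrite -currentNC -[X in _ <= _ + _ * X]sqmodN current_le.
rewrite (_ : n%:Z + 1 = n.+1%:Z) ?current_le //; lia.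
Qed.

Lemma l2_end_state_bounded J f : l2_end f ->
  exists C : R, forall n, enorm (state J f (cut n)) <= C.
Proof.
move=> /l2_halfE /l2_half_bounded [C hC]; have [A hA] := end_coef_bounded J.
have hf n : sqmod (f (cut n)) <= C /\ sqmod (f (cut n + 1)) <= C.
  have := hC n; have := hC n.+1; rewrite /= /site /cut; case: left.
    rewrite (_ : 1 - n.+1%:Z = - n%:Z); last by lia.
    by rewrite (_ : 1 - n%:Z = - n%:Z + 1); last by lia.
  by rewrite (_ : n%:Z + 1 = n.+1%:Z); last by lia.
have A0 : 0 <= A := le_trans (ltW (end_coef_gt0 J 0)) (hA 0).
exists (Num.sqrt (C + A ^+ 2 * C)) => n.
rewrite -[leLHS]ger0_norm ?enorm_ge0 // -sqrtr_sqr ler_wsqrtr //.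
rewrite enorm_state_sqr lerD ?(hf n).2 //.
rewrite ler_pM ?sqr_ge0 ?sqmod_ge0 ?(hf n).1 //.
by rewrite ler_pXn2r ?nnegrE ?A0 ?(ltW (ja_gt0 _ _)) //; exact: hA.
Qed.

(** * Moving a Weyl solution by an intertwining matrix *)

(** The common value of [m_plus] and of [- m_minus] on the respective Weyl
solutions. *)
Definition slope J f : R[i] := state J f 0 0 0 / state J f 0 1 0.

(** Transported along the chosen end by the two families of transfer matrices,
[B] becomes [Bn]; as [Bn] is bounded infinitely often, [B] maps initial states
of Weyl solutions to initial states of Weyl solutions. *)
Lemma weyl_slope_lft J J' (B : 'M[R[i]]_2) (Bn : nat -> 'M[R[i]]_2) f h :
  \det B = 1 ->
  (forall n, transfer z (cut n) J' *m B = Bn n *m transfer z (cut n) J) ->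
  (limn_einf (fun n => (opnorm (Bn n))%:E) < +oo)%E ->
  weyl J f -> weyl J' h ->
  (Some (slope J' h) : riemann_sphere R) = lft B (Some (slope J f)).
Proof.
move=> dB BBn /limn_einf_lty [C hC] wf wh.
have [_ hf lf] := wf.
have [f0 f1] := weyl_neq0 wf; have [h0 h1] := weyl_neq0 wh.
have [F hF sF] := solution_exists z J' (B *m state J f 0).
have sFn n : state J' F (cut n) = Bn n *m state J f (cut n).
  by rewrite (state_transfer _ hF) sF mulmxA BBn -mulmxA -state_transfer.
have [D hD] := l2_end_state_bounded J lf.
have D0 : 0 <= D := le_trans (enorm_ge0 _) (hD 0).
have lF : l2_end F.
  apply/l2_halfE.
  apply: (l2_half_of_flux z_upper (solution_half hF)
            (C := (`|C| * D) ^+ 2)) => N.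
  have [n Nn hn] := hC N; exists n => //.
  rewrite (le_trans (flux_le_state _ _ _)) // sFn.
  rewrite ler_pXn2r ?nnegrE ?enorm_ge0 ?mulr_ge0 //.
  rewrite (le_trans (enorm_mulmx _ _)) //.
  apply: (@le_trans _ _ (`|C| * enorm (state J f (cut n)))).
    by rewrite ler_wpM2r ?enorm_ge0 // (le_trans hn) // ler_norm.
  by rewrite ler_wpM2l.
have wF : weyl J' F.
  split=> //; apply/not_existsP => F0; move/eqP: f0; apply.
  have Fz n : F n = 0 by apply/eqP/negbNE/negP => /F0.
  have : B *m state J f 0 = 0.
    by rewrite -sF; apply: cV2P; rewrite !mxE /= !Fz ?mulr0.
  move=> /(mulmx_eq0_det1 dB) /(congr1 (fun v : 'cV_2 => v 1 0)).
  rewrite !mxE /= => /eqP; rewrite mulNr oppr_eq0 mulf_eq0.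
  by rewrite (negbTE (ja_neq0 _ _)); move=> /eqP.
have [F0 F1] := weyl_neq0 wF; have Fh := weyl_unique wF wh.
have a0 := ja_neq0 J 0; have a0' := ja_neq0 J' 0.
have y1 : state J f 0 1 0 != 0 by rewrite mxE /= mulf_neq0 ?oppr_eq0.
have Fy1 : state J' F 0 1 0 != 0 by rewrite mxE /= mulf_neq0 ?oppr_eq0.
have -> : slope J' h = slope J' F.
  rewrite /slope !mxE /= add0r.
  apply/eqP; rewrite eqr_div ?mulf_neq0 ?oppr_eq0 //; apply/eqP.
  transitivity (- (ja J' 0)%:C%C * (F 0 * h 1)); first by ring.
  by rewrite Fh; ring.
rewrite /lft /slope sF.
have E i : B i 0 * (state J f 0 0 0 / state J f 0 1 0) + B i 1 =
    (B *m state J f 0) i 0 / state J f 0 1 0.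
  by rewrite mulmx2E; field.
rewrite !E mulf_eq0 invr_eq0 -sF (negbTE y1) (negbTE Fy1) /=; congr Some.
by field; rewrite y1.
Qed.

End Ends.
Theorem theorem2p3 (R : realType) (G : zmodType)
  (iota : {additive int -> G}) (iota_inj : injective iota)
  (act : G -> jacobi R -> jacobi R)
  (act0 : forall J, act 0 J = J)
  (actD : forall g h J, act (g + h) J = act g (act h J))
  (act_shift : forall (n : int) J, act (iota n) J = jshift n J)
  (z : R[i]) (z_upper : 0 < complex.Im z)
  (T : G -> jacobi R -> 'M[R[i]]_2)
  (T_SL2 : forall g J, \det (T g J) = 1)
  (T_cocycle : forall g h J, T (g + h) J = T g (act h J) *m T h J)
  (T_shift : forall (n : int) J, T (iota n) J = transfer z n J)
  (g : G) (J : jacobi R)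
  (liminf_pinfty :
    (limn_einf (fun n : nat => (opnorm (T g (act (iota n%:Z) J)))%:E) < +oo)%E)
  (liminf_ninfty :
    (limn_einf (fun n : nat => (opnorm (T g (act (iota (- n%:Z)) J)))%:E)
      < +oo)%E) :
  (Some (m_plus z (act g J)) : riemann_sphere R)
    = lft (T g J) (Some (m_plus z J)) /\
  (Some (- m_minus z (act g J)) : riemann_sphere R)
    = lft (T g J) (Some (- m_minus z J)).
Proof.
(* The cocycle identity for [n + g] and for [g + n]. *)
have swap n : transfer z n (act g J) *m T g J =
    T g (act (iota n) J) *m transfer z n J.
  by rewrite -!T_shift -!T_cocycle addrC.
have weyl_xget left K :
    weyl z left K (xget (fun=> 0) (weyl_solution (l2_end left) z K)).
  by apply: xgetPex; exact: weyl_exists.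
have m_plusE K : m_plus z K = slope K (f_plus z K).
  by rewrite /m_plus /slope !mxE /= add0r mulNr invrN mulrN.
have m_minusE K : - m_minus z K = slope K (f_minus z K).
  by rewrite /m_minus /slope !mxE /= add0r mulNr invrN mulrN.
split.
  rewrite !m_plusE.
  apply: (weyl_slope_lft z_upper (left := false)) liminf_pinfty _ _.
  - exact: T_SL2.
  - by move=> n; exact: swap.
  - exact: weyl_xget.
  - exact: weyl_xget.
rewrite !m_minusE.
apply: (weyl_slope_lft z_upper (left := true)) liminf_ninfty _ _.
- exact: T_SL2.
- by move=> n; exact: swap.
- exact: weyl_xget.
- exact: weyl_xget.
Qed.
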